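(* Let $n\geq 1$. Then for any skew diagram $\lambda/\mu$ of size $n$, the set-valued statistics $\mathrm{Peak}$ and $\mathrm{Val}$ are equidistributed over $\mathrm{SYT}(\lambda/\mu)$, that is, $$\sum_{T \in \mathrm{SYT}(\lambda/\mu)}t^{\mathrm{Peak}(T)} = \sum_{T \in \mathrm{SYT}(\lambda/\mu)}t^{\mathrm{Val}(T)}.$$
   Context: Young diagrams are identified with integer partitions $\lambda=(\lambda_1\ge\lambda_2\ge\cdots)$ and drawn left-justified with rows numbered from top to bottom. For partitions $\mu\subseteq\lambda$ (i.e. $\mu_i\le\lambda_i$ for all $i$), the skew diagram $\lambda/\mu$ is obtained from $\lambda$ by removing $\mu$ at the top-left corner; its size is $|\lambda|-|\mu|$. A standard Young tableau (SYT) of shape $\lambda/\mu$ of size $n$ is a filling of the squares of $\lambda/\mu$ with the numbers $1,2,\ldots,n$ (each used once) that increases along each row (left to right) and each column (top to bottom). $\mathrm{SYT}(\lambda/\mu)$ is the set of all of them. For an SYT $T$ with $n$ entries, an index $i$ with $1\le i\le n-1$ is a descent of $T$ if $i+1$ appears in a lower row of $T$ than $i$, and is an ascent otherwise. An index $i$ with $2\le i\le n-1$ is a peak of $T$ if $i-1$ is an ascent and $i$ is a descent, and is a valley of $T$ if $i-1$ is a descent and $i$ is an ascent. $\mathrm{Peak}(T)$ and $\mathrm{Val}(T)$ are the sets of peaks and of valleys of $T$. For a finite set $A$ of positive integers, $t^A=\prod_{i\in A}t_i$ with $t_1,t_2,\ldots$ commuting indeterminates, and $t^{\emptyset}=1$.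 *)

(* Defs.v *)
From HB Require Import structures.
From mathcomp Require Import all_boot all_order all_algebra.
From mathcomp Require Import finmap.
From mathcomp.multinomials Require Import monalg.

Set Implicit Arguments.
Unset Strict Implicit.
Unset Printing Implicit Defensive.

Import GRing.Theory.

(* A partition is the list of its positive parts; [nth 0 la i] is the part of
   (0-based) index i, which is 0 beyond the last row. *)
Definition is_partition (la : seq nat) : bool := sorted geq la && (0 \notin la).

Definition part_included (mu la : seq nat) : Prop :=
  forall i, nth 0 mu i <= nth 0 la i.

(* Squares are pairs (row, column), 0-based, rows numbered from top to bottom;
   the rectangle below contains the whole diagram of la. *)
Definition in_skew (la mu : seq nat) (c : 'I_(size la) * 'I_(head 0 la)) : bool :=
  nth 0 mu c.1 <= c.2 < nth 0 la c.1.

Notation skew_square la mu := {c | @in_skew la mu c}.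

Section Tableaux.
Variables (n : nat) (la mu : seq nat).
Implicit Types (T : {ffun skew_square la mu -> 'I_n}) (c d : skew_square la mu).

Definition square_row c : nat := (val c).1.
Definition square_col c : nat := (val c).2.

(* Fillings take values in {0, ..., n-1}; the number written in a square is
   the successor of that value, in {1, ..., n}. *)
Definition entry T c : nat := (T c).+1.

Definition is_SYT T : bool :=
  [&& [forall k : 'I_n, #|[set c | entry T c == k.+1]| == 1],
      [forall c, forall d, (square_row c == square_row d) &&
         (square_col c < square_col d) ==> (entry T c < entry T d)]
    & [forall c, forall d, (square_col c == square_col d) &&
         (square_row c < square_row d) ==> (entry T c < entry T d)]].

Definition is_descent T (i : nat) : bool :=
  (1 <= i < n) &&
  [exists c, exists d, [&& entry T c == i, entry T d == i.+1
                         & square_row c < square_row d]].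

Definition is_ascent T (i : nat) : bool := (1 <= i < n) && ~~ is_descent T i.

Definition Peak T : {fset nat} :=
  [fset i in index_iota 2 n | is_ascent T i.-1 && is_descent T i]%fset.

Definition Val T : {fset nat} :=
  [fset i in index_iota 2 n | is_descent T i.-1 && is_ascent T i]%fset.

End Tableaux.

Definition SYT (n : nat) (la mu : seq nat) :
  {set {ffun skew_square la mu -> 'I_n}} := [set T | is_SYT T].

(* Polynomials with integer coefficients in countably many commuting
   indeterminates t_i, i : nat (t_0 plays no role). *)
Notation polyZ := {malg int[{cmonom nat}]}.

Definition indet (i : nat) : polyZ := << @ucm nat i >>%R.

Definition tmon (A : {fset nat}) : polyZ := (\prod_(i <- A) indet i)%R.

(* Main.v *)
Require Import Defs.
From mathcomp Require Import all_boot all_order all_algebra.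
From mathcomp Require Import finmap.
From mathcomp.multinomials Require Import monalg.
From mathcomp Require Import zify.

(* Cut {1, ..., n} into blocks of consecutive entries, and call T peak-free
   (valley-free) if it has no peak (valley) i with i-1, i, i+1 in one block.
   The marked fillings behind Schur Q-functions show that there are as many
   peak-free as valley-free tableaux.  In a peak-free tableau every block is a
   run of descents followed by a run of ascents, that is, a vertical strip
   followed by a horizontal one.  Marking which cells belong to the horizontal
   strips (one entry of each block, the pivot, may be marked either way), T can
   be recovered from the block of each cell and the marks.  Given the blocks,
   the mark of a cell is forced by a neighbour below, or to the left, in the
   same block, and is free otherwise; the two requirements collide exactly when
   a block contains a 2 x 2 square.  Hence the number of marks is a power of 2
   that depends only on the numbers of vertical and of horizontal adjacencies
   inside blocks.  This count is invariant under transposition of the diagram,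
   which exchanges ascents and descents, hence peaks and valleys.

   Peak sets and valley sets contain no two consecutive integers.  Cutting next
   to the elements of S counts the tableaux whose peak set lies in a certain
   neighbourhood of S, and among the sparse subsets of that neighbourhood S has
   the largest weight; a triangular induction on the weight then gives the
   number of tableaux with a prescribed peak or valley set. *)

Set Implicit Arguments.
Unset Strict Implicit.
Unset Printing Implicit Defensive.

(** * Ranks and markings *)

Definition rank (D : finType) (lt : rel D) (c : D) := #|[set d | lt d c]|.

Section Rank.
Variables (D : finType) (lt : rel D).
Hypothesis lt_irr : irreflexive lt.
Hypothesis lt_trans : transitive lt.
Hypothesis lt_total : forall c d, c != d -> lt c d || lt d c.

(** The predecessors of an element of [S] form a proper subset of [S], while by totality an element
    outside [S] is preceded by all of [S]. *)
Lemma rank_initial (S : {set D}) c :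
  (forall d e, lt d e -> e \in S -> d \in S) -> (c \in S) = (rank lt c < #|S|).
Proof.
move=> downS; apply/idP/idP => [cS | ].
  apply/proper_card/properP; split.
    by apply/subsetP=> d; rewrite inE => /downS; apply.
  by exists c => //; rewrite inE lt_irr.
apply: contraTT => cS; rewrite -leqNgt; apply/subset_leq_card/subsetP=> d dS.
have cd : d != c by apply: contraNneq cS => <-.
rewrite inE; case/orP: (lt_total cd) => // /downS/(_ dS) cS'.
by rewrite cS' in cS.
Qed.

Lemma rank_mono c d : (rank lt c < rank lt d) = lt c d.
Proof.
by rewrite -rank_initial ?inE // => e f; rewrite !inE; apply: lt_trans.
Qed.

Lemma rank_lt_card c : rank lt c < #|D|.
Proof. by rewrite -cardsT -rank_initial ?inE. Qed.

Lemma rank_inj : injective (rank lt).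
Proof.
move=> c d eq_cd; apply/eqP; apply: contraPT (eq_cd) => /lt_total.
by rewrite -!rank_mono eq_cd ltnn.
Qed.

End Rank.

Lemma rank_ord n (i : 'I_n) : rank (fun j k : 'I_n => j < k) i = i.
Proof.
rewrite /rank -sum1dep_card -(big_ord_widen n (fun=> 1)) ?sum1_card ?card_ord //.
exact: ltnW.
Qed.

Section Markings.
Variable C : finType.
Implicit Types (r s : rel C) (m : {ffun C -> bool}).

Definition graph r : {set C * C} := [set p | r p.1 p.2].

Definition partial_injection r : Prop :=
  (forall c d e, r c d -> r c e -> d = e) /\
  (forall c d e, r c e -> r d e -> c = d).

(** Up to transposition, [r] will consist of downward steps and [s] of rightward ones; the marked
    cells are those of the horizontal strips. *)
Definition marking r s m : bool :=
  [forall c, forall d, (r c d ==> ~~ m c) && (s c d ==> m d)].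

(** The middle cell would have to be both marked and unmarked. For ascents followed by descents it
    is a peak inside a block. *)
Definition chain s r : bool :=
  [exists c, exists d, exists e, s c d && r d e].

Lemma markingP r s m :
  reflect ((forall c d, r c d -> ~~ m c) /\ (forall c d, s c d -> m d))
          (marking r s m).
Proof.
apply: (iffP forallP) => [mP | [rP sP] c].
  by split=> c d; have /forallP/(_ d)/andP[] := mP c => /implyP rP /implyP.
by apply/forallP=> d; apply/andP; split; apply/implyP; [apply: rP | apply: sP].
Qed.

(** The values are chosen independently: a cell has no admissible value in [A :&: B], two outside
    [A :|: B], and one otherwise. *)
Lemma card_fixed_ffun (A B : {set C}) :
  #|[set m : {ffun C -> bool} | [forall c, ((c \in A) ==> ~~ m c) && ((c \in B) ==> m c)]]|
  = if [disjoint A & B] then 2 ^ (#|C| - (#|A| + #|B|)) else 0.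
Proof.
pose F (c : C) := [pred b | ((c \in A) ==> ~~ b) && ((c \in B) ==> b)].
transitivity (\prod_c #|F c|).
  transitivity #|family F|.
    by rewrite cardsE; apply: eq_card => m; rewrite !inE; apply: eq_forallb => c; rewrite !inE.
  by rewrite card_family foldrE big_map big_enum.
have cardF c : #|F c| = if c \in A :&: B then 0 else if c \in ~: (A :|: B) then 2 else 1.
  rewrite -sum1_card big_mkcond big_bool /= !inE /=.
  by case: (c \in A); case: (c \in B).
case: (boolP [disjoint A & B]) => [dAB | /pred0Pn[c cAB]]; last first.
  by rewrite (bigD1 c) //= cardF inE; case/andP: cAB => /= -> ->.
have AB0 : A :&: B = set0 by apply/eqP; rewrite setI_eq0.
rewrite -(cardsUI A B) AB0 cards0 addn0 -[A :|: B]setCK -cardsCs -prod_nat_const [RHS]big_mkcond.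
by apply: eq_bigr => c _; rewrite cardF AB0 inE.
Qed.

Lemma card_domain r : partial_injection r ->
  #|[set c | [exists d, r c d]]| = #|graph r|.
Proof.
case=> rfun _.
have inj1 : {in graph r &, injective fst}.
  move=> [c d] [c' e]; rewrite !inE /= => cd ce eq_c.
  by rewrite -eq_c in ce *; rewrite (rfun _ _ _ cd ce).
rewrite -(card_in_imset inj1); congr #|pred_of_set _|; apply/setP=> c.
rewrite inE; apply/existsP/imsetP => [[d cd] | [[c' d]]].
  by exists (c, d); rewrite ?inE.
by rewrite inE /= => cd ->; exists d.
Qed.

Lemma card_codomain r : partial_injection r ->
  #|[set d | [exists c, r c d]]| = #|graph r|.
Proof.
case=> _ rinj.
have inj2 : {in graph r &, injective snd}.
  move=> [c d] [e d']; rewrite !inE /= => cd ed eq_d.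
  by rewrite -eq_d in ed *; rewrite (rinj _ _ _ cd ed).
rewrite -(card_in_imset inj2); congr #|pred_of_set _|; apply/setP=> d.
rewrite inE; apply/existsP/imsetP => [[c cd] | [[c d']]].
  by exists (c, d); rewrite ?inE.
by rewrite inE /= => cd ->; exists c.
Qed.

(** A partial injection has as many sources, and as many targets, as edges, so the forced cells are
    counted by edges. *)
Lemma card_marking r s : partial_injection r -> partial_injection s ->
  #|[set m | marking r s m]| =
  if chain s r then 0 else 2 ^ (#|C| - (#|graph r| + #|graph s|)).
Proof.
move=> r_inj s_inj; rewrite -(card_domain r_inj) -(card_codomain s_inj).
set A := [set c | [exists d, r c d]]; set B := [set d | [exists c, s c d]].
have -> : chain s r = ~~ [disjoint A & B].
  apply/idP/pred0Pn => [/existsP[c /existsP[d /existsP[e /andP[cd de]]]] | [d]].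
    by exists d; rewrite /= !inE; apply/andP; split; apply/existsP; [exists e | exists c].
  rewrite /= !inE => /andP[/existsP[e de] /existsP[c cd]].
  by apply/existsP; exists c; apply/existsP; exists d; apply/existsP; exists e; rewrite cd.
rewrite if_neg -card_fixed_ffun; congr #|pred_of_set _|; apply/setP=> m.
rewrite !inE; apply/markingP/forallP => [[rP sP] c | mP].
  rewrite !inE; apply/andP; split; apply/implyP => /existsP[d]; first exact: rP.
  exact: sP.
split=> c d cd.
  have /andP[/implyP + _] := mP c; apply; rewrite inE; apply/existsP; by exists d.
have /andP[_ /implyP] := mP d; apply; rewrite inE; apply/existsP; by exists c.
Qed.

End Markings.

(** * Tableaux with the entries cut into blocks *)

Section Cells.
Variables (C : finType) (n N : nat).
Implicit Types (row col : C -> nat) (T : {ffun C -> 'I_n}) (b : {ffun C -> 'I_N}).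
Implicit Types (c d e : C) (bl : 'I_n -> 'I_N) (m : {ffun C -> bool}).

(** Convexity for the northwest order on an abstract set of cells; transposing the diagram amounts
    to swapping [row] and [col]. *)
Definition skew_shape row col : Prop :=
  (forall c d, row c = row d -> col c = col d -> c = d) /\
  (forall c d i j, row c <= i <= row d -> col c <= j <= col d ->
     exists2 e, row e = i & col e = j).

Definition northwest row col : rel C :=
  fun c d => (row c <= row d) && (col c <= col d).

Definition standard row col T : bool :=
  injectiveb T &&
  [forall c, forall d, (c != d) && northwest row col c d ==> (T c < T d)].

Definition step (bl : 'I_n -> 'I_N) T : rel C :=
  fun c d => (T d == (T c).+1 :> nat) && (bl (T c) == bl (T d)).

Definition desc row bl T : rel C := fun c d => step bl T c d && (row c < row d).

Definition asc row bl T : rel C := fun c d => step bl T c d && ~~ (row c < row d).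

Definition successor row col b : rel C :=
  fun c d => [&& row d == (row c).+1, col c == col d & b c == b d].

(** Block sizes are prescribed cumulatively, the form to which [rank_initial] applies. *)
Definition block_filling row col bl b : bool :=
  [forall c, forall d, northwest row col c d ==> (b c <= b d)] &&
  [forall j : 'I_N, #|[set c | b c < j]| == #|[set i | bl i < j]|].

Lemma skew_shapeC row col : skew_shape row col -> skew_shape col row.
Proof.
case=> [inj conv]; split=> [c d ? ? | c d i j ci cj]; first exact: inj.
by have [e] := conv c d j i cj ci; exists e.
Qed.

Lemma northwestC row col : northwest row col =2 northwest col row.
Proof. by move=> c d; apply: andbC. Qed.

Lemma standardC row col T : standard row col T = standard col row T.
Proof.
congr (_ && _); apply: eq_forallb => c; apply: eq_forallb => d.
by rewrite northwestC.
Qed.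

Lemma block_fillingC row col bl b :
  block_filling row col bl b = block_filling col row bl b.
Proof.
congr (_ && _); apply: eq_forallb => c; apply: eq_forallb => d.
by rewrite northwestC.
Qed.

Lemma successor_pinj row col b :
  skew_shape row col -> partial_injection (successor row col b).
Proof.
case=> inj _; split=> c d e /and3P[/eqP r1 /eqP c1 _] /and3P[/eqP r2 /eqP c2 _].
  by apply: inj; lia.
by apply: inj; lia.
Qed.

Lemma step_pinj bl T : injective T -> partial_injection (step bl T).
Proof.
move=> injT; split=> c d e /andP[/eqP s1 _] /andP[/eqP s2 _].
  by apply/injT/val_inj => /=; lia.
by apply/injT/val_inj => /=; lia.
Qed.

Lemma sub_pinj (r s : rel C) :
  subrel r s -> partial_injection s -> partial_injection r.
Proof.
move=> sub [fs js]; split=> c d e rcd rce.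
  exact: (fs c) (sub _ _ rcd) (sub _ _ rce).
exact: (js c d e) (sub _ _ rcd) (sub _ _ rce).
Qed.

(* Each chain spans a 2 x 2 square of one block, which contains the other chain. *)
Lemma chain_square row col b :
    skew_shape row col -> (forall c d, northwest row col c d -> b c <= b d) ->
  chain (successor col row b) (successor row col b) ->
  chain (successor row col b) (successor col row b).
Proof.
case=> inj conv mono.
move=> /existsP[c /existsP[d /existsP[e /andP[]]]].
move=> /and3P[/eqP c1 /eqP r1 /eqP b1] /and3P[/eqP r2 /eqP c2 /eqP b2].
have [f rf cf] : exists2 f, row f = row e & col f = col c by apply: (conv c e); lia.
have bf : b c = b f.
  apply/val_inj/eqP; rewrite eqn_leq mono /northwest; last by lia.
  by rewrite b1 b2 mono // /northwest; lia.
apply/existsP; exists c; apply/existsP; exists f; apply/existsP; exists e.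
by rewrite /successor bf -b2 -b1 -bf rf cf r2 r1 -c2 c1 !eqxx.
Qed.

Section Standard.
Variables (row col : C -> nat).
Hypothesis shape : skew_shape row col.

Let inj_cell : forall c d, row c = row d -> col c = col d -> c = d := shape.1.
Let conv : forall c d i j, row c <= i <= row d -> col c <= j <= col d ->
  exists2 e, row e = i & col e = j := shape.2.

Lemma standard_inj T : standard row col T -> injective T.
Proof. by case/andP=> /injectiveP. Qed.

Lemma standard_lt T c d : standard row col T -> c != d ->
  row c <= row d -> col c <= col d -> T c < T d.
Proof.
move=> /andP[_ /forallP/(_ c)/forallP/(_ d)/implyP T_lt] cd rcd ccd.
by apply: T_lt; rewrite cd /northwest rcd.
Qed.

(* Otherwise the entry at the corner (row c, col d) would lie strictly between
   the consecutive entries of c and d. *)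
Lemma standard_step T c d : standard row col T -> T d = (T c).+1 :> nat ->
  (col c < col d) = ~~ (row c < row d).
Proof.
move=> T_std Tcd; have neq_cd : c != d by apply/eqP=> E; rewrite E in Tcd; lia.
apply/idP/idP => [ccd | ]; last first.
  apply: contraR; rewrite -!leqNgt => ccd; rewrite ltnNge; apply/negP => rcd.
  by have := standard_lt T_std _ rcd ccd; rewrite eq_sym => /(_ neq_cd); lia.
apply/negP=> rcd.
have [e re ce] : exists2 e, row e = row c & col e = col d by apply: (@conv c d); lia.
have ec : c != e by apply/eqP=> E; rewrite E in ccd; lia.
have ed : e != d by apply/eqP=> E; rewrite E in re; lia.
have := standard_lt T_std ec; have := standard_lt T_std ed; lia.
Qed.


(* Reading order: block by block, first the unmarked cells from top to bottom,
   then the marked ones from left to right. *)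
Definition key_lt b m : rel C := fun c d =>
  (b c < b d) || (b c == b d) &&
    (if m c then m d && (col c < col d) else m d || (row c < row d)).

Lemma key_lt_irr b m : irreflexive (key_lt b m).
Proof. by move=> c; rewrite /key_lt !ltnn eqxx; case: (m c). Qed.

Lemma key_lt_trans b m : transitive (key_lt b m).
Proof.
move=> d c e; rewrite /key_lt -!val_eqE.
case: (m c) (m d) (m e) => [] [] [] /=; lia.
Qed.

Section Marked.
Variables (bl : 'I_n -> 'I_N) (m : {ffun C -> bool}).
Hypothesis card_cells : #|C| = n.
Hypothesis bl_mono : forall i j : 'I_n, i <= j -> bl i <= bl j.

Lemma standard_bij T : standard row col T -> bijective T.
Proof. by move=> /standard_inj T_inj; apply: inj_card_bij; rewrite // card_ord card_cells. Qed.

(** * From a marked standard filling to its blocks *)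

Section FromStandard.
Variable T : {ffun C -> 'I_n}.
Hypothesis T_std : standard row col T.
Hypothesis T_mark : marking (desc row bl T) (asc row bl T) m.
Let b : {ffun C -> 'I_N} := [ffun c => bl (T c)].

(** Induction on [T d - T c]. For one step, a descent makes the first cell unmarked and an ascent
    makes the second marked and moves right by [standard_step]. So each block is an unmarked run
    going down, then a marked run going right. *)
Lemma marked_run c d : T c < T d -> bl (T c) = bl (T d) ->
  (m c -> m d && (col c < col d)) /\ (~~ m d -> ~~ m c && (row c < row d)).
Proof.
have [desc_m asc_m] := markingP _ _ _ T_mark.
have [g gK Kg] := standard_bij T_std.
move Dk: (T d - T c) => k; elim: k d Dk => [|k IHk] d Dk Tcd bl_cd; first lia.
have ltn_e : (T d).-1 < n by have := ltn_ord (T d); lia.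
pose e := g (Ordinal ltn_e).
have Te : T e = (T d).-1 :> nat by rewrite Kg.
have Ted : T d = (T e).+1 :> nat by lia.
(* The entry of [e] lies between those of [c] and [d], and [bl] is monotone. *)
have bl_ed : bl (T e) = bl (T d).
  apply/val_inj/eqP; rewrite /= eqn_leq bl_mono -?bl_cd ?bl_mono //; lia.
have ed : step bl T e d by rewrite /step Ted bl_ed !eqxx.
have ccol := standard_step T_std Ted.
have me_d : (m e -> m d && (col e < col d)) /\ (~~ m d -> ~~ m e && (row e < row d)).
  case rcd: (row e < row d) ccol => /= ccol.
    have /desc_m me : desc row bl T e d by rewrite /desc ed.
    by rewrite (negPf me).
  by have /asc_m -> : asc row bl T e d by rewrite /asc ed rcd.
case: (posnP k) => [k0 | k_gt0].
  suff -> : c = e by [].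
  by apply/(bij_inj (standard_bij T_std))/val_inj; rewrite /= Te; lia.
have /IHk : T e - T c = k by rewrite Te; lia.
rewrite Te bl_ed bl_cd => /(_ _ erefl) IH; have {}IH := IH ltac:(lia).
by move: me_d IH; case: (m c) (m d) (m e) => [] [] [] /=; intuition lia.
Qed.

(** One direction is [marked_run]; the converse follows since entries are totally ordered and
    [key_lt] is a strict order. *)
Lemma key_lt_standard c d : key_lt b m c d = (T c < T d).
Proof.
have lt_key e f : T e < T f -> key_lt b m e f.
  move=> lt_ef; rewrite /key_lt !ffunE -val_eqE.
  have := bl_mono (ltnW lt_ef); rewrite leq_eqVlt => /orP[/eqP/val_inj bl_ef | ->] //.
  rewrite bl_ef eqxx ltnn /=; have [] := marked_run lt_ef bl_ef.
  by case: (m e) (m f) => [] [] /=; lia.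
apply/idP/idP => [lt_cd | ]; last exact: lt_key.
case: (ltngtP (T c) (T d)) => // [/lt_key lt_dc | /val_inj/(standard_inj T_std) eq_cd].
  by have := key_lt_trans lt_cd lt_dc; rewrite key_lt_irr.
by rewrite eq_cd key_lt_irr in lt_cd.
Qed.

Lemma standard_rank c : rank (key_lt b m) c = T c.
Proof.
rewrite -(rank_ord (T c)) /rank -(on_card_preimset (f := T)); last first.
  exact/onW_bij/standard_bij.
by congr #|pred_of_set _|; apply/setP=> d; rewrite !inE key_lt_standard.
Qed.

Lemma block_filling_standard : block_filling row col bl b.
Proof.
apply/andP; split.
  apply/forallP=> c; apply/forallP=> d; apply/implyP=> /andP[rcd ccd]; rewrite !ffunE.
  have [-> // | cd] := eqVneq c d.
  exact/bl_mono/ltnW/(standard_lt T_std).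
apply/forallP=> j; rewrite -(on_card_preimset (f := T)); last first.
  exact/onW_bij/standard_bij.
by apply/eqP; congr #|pred_of_set _|; apply/setP=> c; rewrite !inE ffunE.
Qed.

(** Vertical neighbours share a column, so [key_lt] can put the upper one first only if it is
    unmarked; horizontal neighbours share a row, so the right one must be marked. *)
Lemma marking_standard : marking (successor row col b) (successor col row b) m.
Proof.
have key c d : successor row col b c d || successor col row b c d -> key_lt b m c d /\ b c = b d.
  rewrite key_lt_standard.
  move=> /orP[] /and3P[/eqP H1 /eqP H2 /eqP H3]; split => //;
    apply: (standard_lt T_std); rewrite ?H1 ?H2 //; apply/eqP => E; rewrite E in H1; lia.
apply/markingP; split=> c d sd.
  have [] := key c d; first by rewrite sd.
  rewrite /key_lt => + bcd; rewrite bcd ltnn eqxx /=.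
  case/and3P: sd => _ /eqP -> _; rewrite ltnn andbF.
  by case: (m c).
have [] := key c d; first by rewrite sd orbT.
rewrite /key_lt => + bcd; rewrite bcd ltnn eqxx /=.
case/and3P: sd => _ /eqP -> _; rewrite ltnn orbF.
by case: (m c) => // /andP[].
Qed.

End FromStandard.

(** * From blocks and marks back to a standard filling *)

Section FromBlocks.
Variable b : {ffun C -> 'I_N}.
Hypothesis b_fill : block_filling row col bl b.
Hypothesis b_mark : marking (successor row col b) (successor col row b) m.

Lemma block_mono c d : row c <= row d -> col c <= col d -> b c <= b d.
Proof.
case/andP: b_fill => /forallP/(_ c)/forallP/(_ d)/implyP mono _ rcd ccd.
by apply: mono; rewrite /northwest rcd.
Qed.

Lemma block_between c d e : b c = b d -> row c <= row e <= row d ->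
  col c <= col e <= col d -> b e = b d.
Proof.
move=> bcd /andP[? ?] /andP[? ?]; apply/val_inj/eqP.
by rewrite /= eqn_leq -{2}bcd !block_mono.
Qed.

Lemma marked_right c d : b c = b d -> row c <= row d -> col c < col d -> m d.
Proof.
move=> bcd rcd ccd; have [_ right_m] := markingP _ _ _ b_mark.
(* The left neighbour of [d] is a cell by convexity, and its block is squeezed between those of [c]
   and [d]. *)
have [e re ce] : exists2 e, row e = row d & col e = (col d).-1 by apply: (@conv c d); lia.
apply: (right_m e); rewrite /successor re eqxx (@block_between c d e) ?eqxx //; lia.
Qed.

Lemma unmarked_above c d : b c = b d -> row c < row d -> col c <= col d -> ~~ m c.
Proof.
move=> bcd rcd ccd; have [below_m _] := markingP _ _ _ b_mark.
have [e re ce] : exists2 e, row e = (row c).+1 & col e = col c by apply: (@conv c d); lia.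
apply: (below_m c e); rewrite /successor re ce !eqxx (@block_between c d e) ?bcd ?eqxx //; lia.
Qed.

Lemma key_lt_northwest c d : c != d -> northwest row col c d -> key_lt b m c d.
Proof.
move=> cd /andP[rcd ccd]; rewrite /key_lt -val_eqE.
case: ltngtP (block_mono rcd ccd) => //= /val_inj bcd _.
have:= @marked_right c d bcd rcd; have := @unmarked_above c d bcd.
have: (row c < row d) || (col c < col d).
  apply: contraNT cd; rewrite negb_or -!leqNgt => /andP[? ?].
  by apply/eqP/inj_cell; lia.
by case: (m c) (m d) => [] [] /=; lia.
Qed.

Lemma key_lt_total c d : c != d -> key_lt b m c d || key_lt b m d c.
Proof.
wlog rcd : c d / row c <= row d => [hwlog cd|].
  case: (leqP (row c) (row d)) => [|/ltnW] rcd; first exact: hwlog.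
  by rewrite orbC hwlog // eq_sym.
move=> cd; case: (leqP (col c) (col d)) => ccd.
  by rewrite key_lt_northwest // /northwest rcd.
rewrite /key_lt -!val_eqE; case: ltngtP => //= bcd.
(* Here [d] is strictly left of [c] and not above it. Two unmarked cells are compared by rows, which
   differ: in a common row [c] would be marked. *)
have [/val_inj {}bcd] := bcd; have:= @marked_right d c (esym bcd).
by case: (m c) (m d) => [] [] //=; lia.
Qed.

Lemma rank_lt_n c : rank (key_lt b m) c < n.
Proof. by rewrite -card_cells; apply: rank_lt_card key_lt_total _; apply: key_lt_irr. Qed.

Definition rank_filling : {ffun C -> 'I_n} := [ffun c => Ordinal (rank_lt_n c)].

Lemma rank_filling_lt c d : (rank_filling c < rank_filling d) = key_lt b m c d.
Proof. by rewrite !ffunE rank_mono //; [apply: key_lt_irr | apply: key_lt_trans | apply: key_lt_total]. Qed.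

Lemma rank_filling_standard : standard row col rank_filling.
Proof.
apply/andP; split.
  apply/injectiveP => c d /(congr1 val); rewrite !ffunE /=; apply: rank_inj key_lt_total _ _.
    exact: key_lt_irr.
  exact: key_lt_trans.
apply/forallP=> c; apply/forallP=> d; apply/implyP=> /andP[cd nw_cd].
by rewrite rank_filling_lt key_lt_northwest.
Qed.

(** The cells of the blocks before [j] are an initial segment for [key_lt], with as many elements as
    the initial segment of entries that [bl] sends before [j]. *)
Lemma bl_rank_filling c : bl (rank_filling c) = b c.
Proof.
have bl_lt (j : 'I_N) : (bl (rank_filling c) < j) = (b c < j).
  pose S := [set i | bl i < j].
  have /andP[_ /forallP/(_ j)/eqP eq_card] := b_fill.
  transitivity (rank_filling c \in S); first by rewrite inE.
  rewrite (rank_initial (lt := fun i k : 'I_n => i < k)); first last.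
  - by move=> i k /ltnW /bl_mono ik; rewrite !inE; apply: leq_ltn_trans.
  - by move=> i k ik; rewrite -neq_ltn.
  - by move=> i; apply: ltnn.
  rewrite rank_ord -eq_card ffunE /= -(rank_initial (lt := key_lt b m)) ?inE //.
  - exact: key_lt_irr.
  - exact: key_lt_total.
  move=> d e; rewrite !inE => /orP[|/andP[/eqP -> //]].
  exact: ltn_trans.
apply/val_inj/eqP; rewrite /= eqn_leq leqNgt -bl_lt ltnn.
by rewrite leqNgt bl_lt ltnn.
Qed.

(** By [standard_step] a descent does not move right, so [key_lt] forbids a mark on its first cell;
    an ascent does not move down, so its second cell is marked. *)
Lemma rank_filling_marking :
  marking (desc row bl rank_filling) (asc row bl rank_filling) m.
Proof.
apply/markingP; split=> c d /andP[/andP[/eqP cd]]; rewrite !bl_rank_filling => /eqP bcd rcd;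
  have := rank_filling_lt c d; rewrite cd ltnSn => /esym;
  rewrite /key_lt bcd ltnn eqxx /=;
  have := standard_step rank_filling_standard cd; case: (m c) (m d) => [] [] //=; lia.
Qed.

End FromBlocks.

(** For fixed [m], composing with [bl] is inverse to ranking the cells by [key_lt b m]. *)
Lemma card_marked_fillings :
  #|[set T | standard row col T && marking (desc row bl T) (asc row bl T) m]| =
  #|[set b | block_filling row col bl b &&
             marking (successor row col b) (successor col row b) m]|.
Proof.
pose f T : {ffun C -> 'I_N} := [ffun c => bl (T c)].
rewrite -(card_in_imset (f := f)); last first.
  move=> T U; rewrite !inE => /andP[T_std T_mark] /andP[U_std U_mark] eq_f.
  apply/ffunP=> c; apply: val_inj => /=.
  by rewrite -(standard_rank T_std T_mark) -(standard_rank U_std U_mark) -/(f T) eq_f.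
congr #|pred_of_set _|; apply/setP=> b; rewrite inE; apply/imsetP/andP.
  move=> [T]; rewrite inE => /andP[T_std T_mark] ->; split.
    exact: block_filling_standard.
  exact: marking_standard.
move=> [b_fill b_mark]; exists (rank_filling b_fill b_mark).
  by rewrite inE rank_filling_standard rank_filling_marking.
by apply/ffunP=> c; rewrite ffunE bl_rank_filling.
Qed.

End Marked.

(** * Double counting and transposition *)

Definition same_block_steps (bl : 'I_n -> 'I_N) :=
  #|[set p : 'I_n * 'I_n | (p.2 == p.1.+1 :> nat) && (bl p.1 == bl p.2)]|.

(** The bijection [T] carries steps between cells to consecutive entries of one block, and each step
    is a descent or an ascent; the total is the same for all [T]. *)
Lemma card_desc_asc bl T : #|C| = n -> standard row col T ->
  #|graph (desc row bl T)| + #|graph (asc row bl T)| = same_block_steps bl.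
Proof.
move=> card_C T_std; have [g gK Kg] := standard_bij card_C T_std.
pose TT p := (T p.1, T p.2).
have TT_bij : bijective TT.
  by exists (fun q => (g q.1, g q.2)) => -[? ?]; rewrite /TT /= ?gK ?Kg.
rewrite /same_block_steps -(on_card_preimset (f := TT)); last exact: onW_bij.
rewrite -(cardsID [set p | row p.1 < row p.2]); congr (_ + _); apply: eq_card => p.
  by rewrite !inE.
by rewrite !inE andbC.
Qed.

(** Pairs ([T], [m]) are counted in two ways. A [T] with a peak inside a block has no marking; every
    other one has the same power of 2 of them. *)
Lemma marked_count bl : #|C| = n -> (forall i j : 'I_n, i <= j -> bl i <= bl j) ->
  #|[set T | standard row col T && ~~ chain (asc row bl T) (desc row bl T)]|
    * 2 ^ (#|C| - same_block_steps bl) =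
  \sum_(b | block_filling row col bl b)
    #|[set m | marking (successor row col b) (successor col row b) m]|.
Proof.
move=> card_C bl_mono.
transitivity (\sum_(T | standard row col T) #|[set m | marking (desc row bl T) (asc row bl T) m]|).
  rewrite -sum1dep_card big_distrl /= big_mkcondr /=; apply: eq_bigr => T T_std.
  have step_inj := step_pinj bl (standard_inj T_std).
  rewrite card_marking; first last.
  - by apply: sub_pinj step_inj => c d /andP[].
  - by apply: sub_pinj step_inj => c d /andP[].
  by rewrite card_desc_asc //; case: chain; rewrite ?mul1n.
transitivity (\sum_m #|[set T | standard row col T && marking (desc row bl T) (asc row bl T) m]|).
  under eq_bigr do rewrite -sum1dep_card.
  rewrite (exchange_big_dep xpredT) //=; apply: eq_bigr => m _.
  by rewrite sum1dep_card.
under eq_bigr do rewrite card_marked_fillings // -sum1dep_card.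
rewrite (exchange_big_dep (block_filling row col bl)) /=; last by move=> m b _ /andP[].
apply: eq_bigr => b b_fill; rewrite -sum1dep_card.
by apply: eq_bigl => m; rewrite b_fill.
Qed.

End Standard.

Lemma card_no_chain row col bl :
    skew_shape row col -> #|C| = n -> (forall i j : 'I_n, i <= j -> bl i <= bl j) ->
  #|[set T | standard row col T && ~~ chain (asc row bl T) (desc row bl T)]| =
  #|[set T | standard row col T && ~~ chain (desc row bl T) (asc row bl T)]|.
Proof.
move=> shape card_C bl_mono; have shape' := skew_shapeC shape.
(* Transposition exchanges ascents and descents, so valley-free becomes peak-free for the transposed
   shape. *)
have -> : [set T | standard row col T && ~~ chain (desc row bl T) (asc row bl T)] =
          [set T | standard col row T && ~~ chain (asc col bl T) (desc col bl T)].
  apply/setP=> T; rewrite !inE standardC; apply: andb_id2l => T_std.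
  have swap c d : step bl T c d -> (col c < col d) = ~~ (row c < row d).
    by case/andP=> /eqP Tcd _; apply: (standard_step shape _ Tcd); rewrite standardC.
  congr (~~ _); apply: eq_existsb => c; apply: eq_existsb => d; apply: eq_existsb => e.
  rewrite /desc /asc; case st_cd: (step bl T c d) => //=.
  case st_de: (step bl T d e); rewrite ?andbF //=.
  by rewrite !swap // negbK.
apply/eqP; rewrite -(@eqn_pmul2r (2 ^ (#|C| - same_block_steps bl))) ?expn_gt0 //.
rewrite (marked_count shape) // (marked_count shape') //; apply/eqP.
(* Term by term, the two adjacency relations trade places: the sum of their sizes is unchanged, and
   by [chain_square] collisions occur for both orders or for neither. *)
rewrite (eq_bigl _ _ (block_fillingC row col bl)); apply: eq_bigr => b b_fill.
have mono c d : northwest row col c d -> b c <= b d.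
  by move: b_fill; rewrite -block_fillingC => /andP[/forallP/(_ c)/forallP/(_ d)/implyP].
have mono' c d : northwest col row c d -> b c <= b d by rewrite northwestC; apply: mono.
have row_inj := successor_pinj b shape; have col_inj := successor_pinj b shape'.
rewrite !card_marking // addnC.
suff -> : chain (successor col row b) (successor row col b) =
          chain (successor row col b) (successor col row b) by [].
by apply/idP/idP; apply: chain_square.
Qed.

End Cells.

(** * From neighbourhoods to prescribed sparse sets *)

Section SparseSets.
Variable n : nat.
Implicit Types (P S : {set 'I_n}) (v w : 'I_n).

Definition sparse P : bool :=
  [forall v in P, forall w in P, w != v.+1 :> nat].

(** Cuts just before the elements of [S] separate [v - 1], [v], [v + 1] exactly when [v] is in this
    set. *)
Definition nearby S : {set 'I_n} :=
  [set v | (v \in S) || [exists w in S, w == v.+1 :> nat]].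

(** The summand is [v.+1] so that the element 0 also adds weight. *)
Definition weight P := \sum_(v in P) v.+1.

(* Moving each v in P outside S to v.+1 in S is injective, since P is sparse,
   and increases the weight. *)
Lemma weight_ltn P S : sparse P -> P \subset nearby S -> P != S ->
  weight P < weight S.
Proof.
move=> /forall_inP spP /subsetP PS neqPS.
have {}spP v w : v \in P -> w \in P -> w != v.+1 :> nat.
  by move=> /spP /forall_inP; apply.
have wsub (A B : {set 'I_n}) : A \subset B -> weight B = weight A + weight (B :\: A).
  by move=> /setIidPr AB; rewrite /weight (big_setID A) /= AB.
have [subPS | /subsetPn[v vP vS]] := boolP (P \subset S).
  have /properP[_ [v vS vP]] : P \proper S by rewrite properEneq neqPS.
  by rewrite (wsub _ _ subPS) /weight (bigD1 v (P := mem (S :\: P))) ?inE ?vP //=; lia.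
pose f v := if v \in S then v else insubd v v.+1.
have f_in w : w \in P -> f w \in S.
  move=> /PS; rewrite inE /f; case: ifP => //= _ /existsP[u /andP[uS /eqP uw]].
  suff -> : insubd w w.+1 = u by [].
  by apply: val_inj; rewrite /= val_insubd -uw ltn_ord.
have fE w : w \in P -> f w = (if w \in S then w : nat else w.+1) :> nat.
  move=> /PS; rewrite inE /f; case: ifP => //= _ /existsP[u /andP[_ /eqP uw]].
  by rewrite val_insubd -uw ltn_ord.
have f_inj : {in P &, injective f}.
  move=> w u wP uP /(congr1 val); rewrite /= !fE //.
  have [wu uw] := (spP u w uP wP, spP w u wP uP).
  by do 2 case: ifP => _; move=> E; apply: val_inj => /=; lia.
have fPS : f @: P \subset S.
  by apply/subsetP=> _ /imsetP[w /f_in wP ->].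
rewrite (wsub _ _ fPS) {2}/weight big_imset //= ltn_addr //.
rewrite /weight !(bigD1 v (P := mem P)) //= -addSn leq_add //.
  by rewrite fE // (negPf vS).
by apply: leq_sum => w /andP[wP _]; rewrite fE //; case: ifP; lia.
Qed.

(** Strong induction on [weight S]: any other subset of [nearby S] is either sparse and lighter, or
    a value of neither function on [A]. *)
Lemma equidistributed_nearby (X : finType) (A : {set X}) (f g : X -> {set 'I_n}) :
    {in A, forall x, sparse (f x)} -> {in A, forall x, sparse (g x)} ->
    (forall S, #|[set x in A | f x \subset nearby S]| =
               #|[set x in A | g x \subset nearby S]|) ->
  forall S, #|[set x in A | f x == S]| = #|[set x in A | g x == S]|.
Proof.
move=> sparse_f sparse_g eq_fg S; have [k] := ubnP (weight S).
elim: k S => // k IHk S; rewrite ltnS => leSk.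
have split_card (h : X -> {set 'I_n}) : #|[set x in A | h x \subset nearby S]| =
    #|[set x in A | h x == S]| +
    \sum_(P : {set 'I_n} | (P \subset nearby S) && (P != S)) #|[set x in A | h x == P]|.
  rewrite -!sum1dep_card (partition_big h (fun P => P \subset nearby S)) /=; last first.
    by move=> x /andP[].
  rewrite (bigD1 S) /=; last by apply/subsetP=> v vS; rewrite inE vS.
  congr (_ + _); last apply: eq_bigr => P /andP[PS _]; rewrite -?sum1dep_card.
    apply: eq_bigl => x; rewrite -andbA; congr (_ && _); case: eqP => [-> | _]; rewrite ?andbF ?andbT //.
    by apply/subsetP=> v vS; rewrite inE vS.
  apply: eq_bigl => x; rewrite -andbA; congr (_ && _).
  by case: eqP => [-> | _]; rewrite ?andbF ?PS.
have := eq_fg S; rewrite !split_card.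
suff -> : \sum_(P : {set 'I_n} | (P \subset nearby S) && (P != S)) #|[set x in A | f x == P]| =
          \sum_(P : {set 'I_n} | (P \subset nearby S) && (P != S)) #|[set x in A | g x == P]|.
  exact: addIn.
apply: eq_bigr => P /andP[PS neqPS].
have [sparseP | not_sparse] := boolP (sparse P).
  by apply: IHk; apply: leq_trans leSk; apply: weight_ltn.
have none (h : X -> {set 'I_n}) : {in A, forall x, sparse (h x)} -> #|[set x in A | h x == P]| = 0.
  move=> sparse_h; apply/eqP; rewrite cards_eq0; apply/eqP/setP=> x; rewrite !inE.
  by apply: contraNF not_sparse => /andP[/sparse_h + /eqP <-].
by rewrite !none.
Qed.

End SparseSets.

Lemma sum_equidistributed (V : nmodType) (X Y : finType) (A : {set X}) (f g : X -> Y)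
    (F : Y -> V) :
  (forall y, #|[set x in A | f x == y]| = #|[set x in A | g x == y]|) ->
  (\sum_(x in A) F (f x) = \sum_(x in A) F (g x))%R.
Proof.
move=> eq_fg.
have regroup (h : X -> Y) : (\sum_(x in A) F (h x) = \sum_y F y *+ #|[set x in A | h x == y]|)%R.
  rewrite (partition_big h xpredT) //=; apply: eq_bigr => y _.
  rewrite (eq_bigr (fun=> F y)) => [|x /andP[_ /eqP ->] //].
  by rewrite big_const -Monoid.iteropE cardsE.
by rewrite !regroup; apply: eq_bigr => y _; rewrite eq_fg.
Qed.

(** * Peaks and valleys *)

Section Turns.
Variables (C : finType) (n : nat).
Implicit Types (T : {ffun C -> 'I_n}) (S : {set 'I_n}) (p q : rel C).

(* Values start from 0, so v stands for the entry v.+1. *)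
Definition turns p q T : {set 'I_n} :=
  [set v | [exists c, exists d, exists e,
    [&& T d == v, T d == (T c).+1 :> nat, T e == (T d).+1 :> nat, p c d & q d e]]].

Lemma turnsP p q T v :
  reflect (exists c d e, [/\ T d = v, T d = (T c).+1 :> nat, T e = (T d).+1 :> nat,
                             p c d & q d e])
          (v \in turns p q T).
Proof.
rewrite inE; apply: (iffP existsP).
  by case=> c /existsP[d /existsP[e /and5P[/eqP ? /eqP ? /eqP ? ? ?]]]; exists c, d, e.
case=> c [d [e [? ? ? pcd qde]]]; exists c; apply/existsP; exists d; apply/existsP; exists e.
by apply/and5P; split; rewrite ?pcd ?qde //; apply/eqP.
Qed.

(** If [v] and [v.+1] were both turns, the step between them would satisfy [q] as the end of one and
    [p] as the start of the other. *)
Lemma turns_sparse p q T : injective T -> (forall c d, p c d -> q c d -> False) ->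
  sparse (turns p q T).
Proof.
move=> injT pq; apply/forall_inP=> v /turnsP[c [d [e [<- cd de pcd qde]]]].
apply/forall_inP=> w /turnsP[c' [d' [e' [<- cd' de' pcd' qde']]]].
apply/eqP => E; apply: (pq d e) => //.
have -> : d = c' by apply/injT/val_inj => /=; lia.
suff -> : e = d' by [].
by apply/injT/val_inj => /=; lia.
Qed.

(* Cuts just before each value of S. *)
Definition cut_block S (i : 'I_n) : 'I_n.+1 := inord #|[set s in S | s <= i]|.

Lemma cut_blockE S i : cut_block S i = #|[set s in S | s <= i]| :> nat.
Proof.
rewrite inordK // ltnS; apply: leq_trans (_ : #|'I_n| <= n); last by rewrite card_ord.
exact: max_card.
Qed.

Lemma cut_block_mono S (i j : 'I_n) : i <= j -> cut_block S i <= cut_block S j.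
Proof.
move=> ij; rewrite !cut_blockE; apply/subset_leq_card/subsetP=> s.
by rewrite !inE => /andP[-> /leq_trans]; apply.
Qed.

Lemma cut_block_step S (i j : 'I_n) : j = i.+1 :> nat ->
  (cut_block S i == cut_block S j) = (j \notin S).
Proof.
move=> ij; rewrite -val_eqE /= !cut_blockE (cardsD1 j [set s in S | s <= j]).
have -> : [set s in S | s <= j] :\ j = [set s in S | s <= i].
  apply/setP=> s; rewrite !inE -val_eqE /= ij; case: (s \in S); rewrite ?andbF //=.
  by lia.
rewrite !inE leqnn andbT; move: #|_| => k.
by case: (j \in S) => /=; lia.
Qed.

(** A turn [v] stays within one block exactly when neither [v] nor [v.+1] is in [S], by
    [cut_block_step]. *)
Lemma chain_turns p q S T : #|C| = n -> injective T ->
  chain (fun c d => step (cut_block S) T c d && p c d)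
        (fun c d => step (cut_block S) T c d && q c d)
  = ~~ (turns p q T \subset nearby S).
Proof.
move=> card_C injT.
have [g gK Kg] : bijective T by apply: inj_card_bij; rewrite ?card_ord ?card_C.
apply/existsP/subsetPn.
  move=> [c /existsP[d /existsP[e]]].
  move=> /andP[/andP[/andP[/eqP cd bcd] pcd] /andP[/andP[/eqP de bde] qde]].
  exists (T d); first by apply/turnsP; exists c, d, e.
  rewrite inE; move: bcd bde; rewrite !cut_block_step // => /negPf -> eS /=.
  apply/existsP=> -[w /andP[wS /eqP wd]].
  suff E : T e = w by rewrite E wS in eS.
  by apply/val_inj; rewrite /= de wd.
move=> [_ /turnsP[c [d [e [<- cd de pcd qde]]]]].
rewrite inE negb_or => /andP[dS /existsPn eS].
exists c; apply/existsP; exists d; apply/existsP; exists e.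
rewrite /step cd de !eqxx !cut_block_step // dS pcd qde /= andbT.
by have := eS (T e); rewrite -cd de eqxx andbT.
Qed.

Variables row col : C -> nat.
Hypothesis shape : skew_shape row col.

Definition lower : rel C := fun c d => row c < row d.
Definition not_lower : rel C := fun c d => ~~ (row c < row d).

Lemma turns_equidistributed S : #|C| = n ->
  #|[set T in [set T | standard row col T] | turns not_lower lower T == S]| =
  #|[set T in [set T | standard row col T] | turns lower not_lower T == S]|.
Proof.
move=> card_C; apply: equidistributed_nearby => [T | T | {}S].
- rewrite inE => /standard_inj T_inj; apply: turns_sparse => // c d.
  by rewrite /not_lower /lower => /negPf ->.
- rewrite inE => /standard_inj T_inj; apply: turns_sparse => // c d.
  by rewrite /not_lower /lower => ->.
transitivity #|[set T | standard row col T && ~~ chain (asc row (cut_block S) T) (desc row (cut_block S) T)]|.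
  apply: eq_card => T; rewrite !inE; apply: andb_id2l => /standard_inj T_inj.
  by rewrite [chain _ _]chain_turns // negbK.
rewrite (card_no_chain shape) //; last exact: cut_block_mono.
apply: eq_card => T; rewrite !inE; apply: andb_id2l => /standard_inj T_inj.
by rewrite [chain _ _]chain_turns // negbK.
Qed.

End Turns.

(** * Young tableaux of skew shape as standard fillings *)

Section SkewTableaux.
Variables (n : nat) (la mu : seq nat).
Hypotheses (hla : is_partition la) (hmu : is_partition mu).
Local Notation C := (skew_square la mu).
Implicit Types (T : {ffun C -> 'I_n}).

Lemma partition_anti (s : seq nat) i j : is_partition s -> i <= j ->
  nth 0 s j <= nth 0 s i.
Proof.
case/andP=> s_sorted _ ij; have [lt_j | ge_j] := ltnP j (size s); last by rewrite nth_default.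
apply: (sorted_leq_nth (leT := geq)) => //; rewrite ?inE //.
- by move=> x y z /= yx xz; apply: leq_trans xz yx.
- exact: leqnn.
exact: leq_ltn_trans lt_j.
Qed.

Lemma skew_shape_diagram : skew_shape (@square_row la mu) (@square_col la mu).
Proof.
split=> [c d rcd ccd | c d i j /andP[ci id] /andP[cj jd]].
  by apply/val_inj/eqP; rewrite -pair_eqE /= -!val_eqE /= -/(square_row c) -/(square_col c) rcd ccd !eqxx.
have /andP[mu_c _] : nth 0 mu (square_row c) <= square_col c < nth 0 la (square_row c) := valP c.
have /andP[_ la_d] : nth 0 mu (square_row d) <= square_col d < nth 0 la (square_row d) := valP d.
have lt_i : i < size la by apply: leq_ltn_trans id (ltn_ord _).
have lt_j : j < head 0 la by apply: leq_ltn_trans jd (ltn_ord _).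
(* Parts decrease, so row [i] of [mu] is at most row [square_row c], and row [i] of [la] at least
   row [square_row d]. *)
have in_ij : in_skew mu (Ordinal lt_i, Ordinal lt_j).
  rewrite /in_skew /= (leq_trans (partition_anti hmu ci)) ?(leq_trans mu_c) //=.
  exact: leq_ltn_trans jd (leq_trans la_d (partition_anti hla id)).
by exists (exist (@in_skew la mu) _ in_ij).
Qed.

(** Each number occurs in exactly one square; hence the existence of a single tableau forces
    [#|C| = n]. *)
Lemma is_SYT_bij T : is_SYT T -> bijective T.
Proof.
case/and3P=> /forallP T1 _ _.
have T_inj : injective T.
  move=> c d eq_cd; have /cards1P[e /setP He] := T1 (T c).
  by have := He c; have := He d; rewrite !inE /entry eq_cd eqxx => /esym/eqP -> /esym/eqP ->.
apply: inj_card_bij => //; rewrite card_ord -[leqLHS]card_ord -(card_codom T_inj).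
apply/subset_leq_card/subsetP=> k _.
have /cards1P[c /setP/(_ c)] := T1 k; rewrite !inE eqxx => /eqP[/val_inj <-].
exact: codom_f.
Qed.

Lemma is_SYT_standard T : #|{: C}| = n ->
  is_SYT T = standard (@square_row la mu) (@square_col la mu) T.
Proof.
move=> card_C; apply/idP/idP => [T_SYT | T_std].
  have [g gK Kg] := is_SYT_bij T_SYT.
  have T_inj := can_inj gK.
  case/and3P: T_SYT => _ /forallP T_row /forallP T_col.
  have rowP c d : square_row c = square_row d -> square_col c <= square_col d -> T c <= T d.
    move=> rcd; rewrite leq_eqVlt => /orP[/eqP ccd|ccd].
      by rewrite ((skew_shape_diagram).1 c d rcd ccd).
    by have /forallP/(_ d) := T_row c; rewrite rcd eqxx ccd /entry /= ltnS => /ltnW.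
  have colP c d : square_col c = square_col d -> square_row c <= square_row d -> T c <= T d.
    move=> ccd; rewrite leq_eqVlt => /orP[/eqP rcd|rcd].
      by rewrite ((skew_shape_diagram).1 c d rcd ccd).
    by have /forallP/(_ d) := T_col c; rewrite ccd eqxx rcd /entry /= ltnS => /ltnW.
  apply/andP; split; first exact/injectiveP.
  apply/forallP=> c; apply/forallP=> d; apply/implyP=> /andP[neq_cd /andP[rcd ccd]].
  rewrite ltn_neqAle (inj_eq val_inj) (inj_eq T_inj) neq_cd /=.
  (* Go along the row of [c] to the corner below which [d] lies, then down the column. *)
  have [|| e re ce] := skew_shape_diagram.2 c d (square_row c) (square_col d).
  - by rewrite leqnn.
  - by rewrite ccd leqnn.
  by apply: (@leq_trans (T e)); [apply: rowP | apply: colP]; rewrite ?re ?ce.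
have [g gK Kg] := standard_bij card_C T_std.
apply/and3P; split.
- apply/forallP=> k; apply/cards1P; exists (g k); apply/setP=> c.
  by rewrite !inE /entry eqSS (inj_eq val_inj) (can2_eq gK Kg).
- apply/forallP=> c; apply/forallP=> d; apply/implyP=> /andP[/eqP rcd ccd].
  rewrite ltnS; apply: (standard_lt T_std); rewrite ?rcd ?(ltnW ccd) //.
  by apply/eqP=> E; rewrite E ltnn in ccd.
apply/forallP=> c; apply/forallP=> d; apply/implyP=> /andP[/eqP ccd rcd].
rewrite ltnS; apply: (standard_lt T_std); rewrite ?ccd ?(ltnW rcd) //.
by apply/eqP=> E; rewrite E ltnn in rcd.
Qed.

Local Notation lower := (lower (@square_row la mu)).
Local Notation not_lower := (not_lower (@square_row la mu)).

Lemma is_descent_step T c d : injective T -> T d = (T c).+1 :> nat ->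
  is_descent T (T c).+1 = lower c d.
Proof.
move=> T_inj Tcd; rewrite /is_descent -Tcd ltn_ord Tcd /=.
apply/existsP/idP => [[c' /existsP[d' /and3P[/eqP Ec /eqP Ed]]] | lt_cd].
  have -> : c' = c by apply/T_inj/val_inj; case: Ec.
  suff -> : d' = d by [].
  by apply/T_inj/val_inj; rewrite /= Tcd; case: Ed.
by exists c; apply/existsP; exists d; rewrite /entry Tcd !eqxx.
Qed.

Lemma is_ascent_step T c d : injective T -> T d = (T c).+1 :> nat ->
  is_ascent T (T c).+1 = not_lower c d.
Proof. by move=> T_inj Tcd; rewrite /is_ascent (is_descent_step T_inj Tcd) -Tcd ltn_ord Tcd. Qed.

Lemma turns_fset T (p q : rel C) (P Q : nat -> bool) : bijective T ->
    (forall c d, T d = (T c).+1 :> nat -> P (T c).+1 = p c d) ->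
    (forall c d, T d = (T c).+1 :> nat -> Q (T c).+1 = q c d) ->
  [fset i in index_iota 2 n | P i.-1 && Q i]%fset =
  [fset (val v).+1 | v in turns p q T]%fset.
Proof.
move=> [g gK Kg] Pp Qq; apply/fsetP=> i; rewrite !inE /= mem_index_iota.
apply/andP/imfsetP => [[/andP[i_gt1 lt_in] /andP[Pi Qi]] | [v /turnsP[c [d [e [<- cd de pcd qde]]]] ->]].
  (* The entries [i - 1], [i], [i + 1] are stored as the values [i - 2], [i - 1], [i]. *)
  have lt1 : i.-1 < n by lia.
  have lt2 : i.-2 < n by lia.
  pose c := g (Ordinal lt2); pose d := g (Ordinal lt1); pose e := g (Ordinal lt_in).
  have Tc : T c = i.-2 :> nat by rewrite Kg.
  have Td : T d = i.-1 :> nat by rewrite Kg.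
  have Te : T e = i :> nat by rewrite Kg.
  exists (T d); last by rewrite /= Td; lia.
  apply/turnsP; exists c, d, e; split=> //; rewrite ?Tc ?Td ?Te; try lia.
    by rewrite -Pp ?Tc ?Td; [have -> : i.-2.+1 = i.-1 by lia | lia].
  by rewrite -Qq ?Td ?Te; [have -> : i.-1.+1 = i by lia | lia].
rewrite /= (Qq _ _ de) qde cd (Pp _ _ cd) pcd; split=> //.
by rewrite -cd -de ltn_ord; lia.
Qed.

Lemma Peak_turns T : bijective T ->
  Peak T = [fset (val v).+1 | v in turns not_lower lower T]%fset.
Proof.
move=> T_bij; have T_inj := bij_inj T_bij.
by apply: turns_fset => // c d cd; [apply: is_ascent_step | apply: is_descent_step].
Qed.

Lemma Val_turns T : bijective T ->
  Val T = [fset (val v).+1 | v in turns lower not_lower T]%fset.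
Proof.
move=> T_bij; have T_inj := bij_inj T_bij.
by apply: turns_fset => // c d cd; [apply: is_descent_step | apply: is_ascent_step].
Qed.

End SkewTableaux.

Theorem theorem1p1 (n : nat) (hn : 1 <= n) (la mu : seq nat)
    (hla : is_partition la) (hmu : is_partition mu)
    (hincl : part_included mu la) (hsize : sumn la - sumn mu = n) :
  (\sum_(T in SYT n la mu) tmon (Peak T) =
   \sum_(T in SYT n la mu) tmon (Val T))%R.
Proof.
(* With a number of squares other than [n] there is no tableau, and both sums are empty. *)
have [card_C | card_neq] := eqVneq #|{: skew_square la mu}| n; last first.
  suff no_SYT T : T \in SYT n la mu = false by rewrite !big_pred0.
  apply/negP; rewrite inE => /is_SYT_bij/bij_eq_card; rewrite card_ord => E.
  by rewrite E eqxx in card_neq.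
have shape := skew_shape_diagram hla hmu.
pose F (P : {set 'I_n}) := tmon [fset (val v).+1 | v in P]%fset.
pose low := lower (@square_row la mu); pose notlow := not_lower (@square_row la mu).
transitivity (\sum_(T in SYT n la mu) F (turns notlow low T))%R.
  by apply: eq_bigr => T; rewrite inE => /is_SYT_bij/Peak_turns ->.
transitivity (\sum_(T in SYT n la mu) F (turns low notlow T))%R; last first.
  by apply: eq_bigr => T; rewrite inE => /is_SYT_bij/Val_turns ->.
apply: sum_equidistributed => S.
have -> : SYT n la mu = [set T | standard (@square_row la mu) (@square_col la mu) T].
  by apply/setP=> T; rewrite !inE is_SYT_standard.
exact: turns_equidistributed.
Qed.
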